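(* Let $p=(p_i)_{i\in\mathbb{N}}$ be a probability distribution over $\mathbb{N}$, let $X^n$ be a sample of $n$ independent observations from $p$, let $\hat p=\hat p(X^n)$ be the MLE of $p$, and let $\delta\in(0,1)$. Then for every even integer $m>0$, with probability at least $1-\delta$, $$\|p-\hat p\|_\infty=\sup_{i\in\mathbb{N}}|p_i-\hat p_i(X^n)|\le \frac1n\left(\frac{1}{\delta^{1/m}}\right)\sum_{k=1}^{m/2}\left(k^{m-k}n^k\sum_{i\in\mathbb{N}}p_i^k(1-p_i)^k\right)^{1/m},$$ and moreover $$\frac1n\left(\frac{1}{\delta^{1/m}}\right)\sum_{k=1}^{m/2}\left(k^{m-k}n^k\sum_{i\in\mathbb{N}}p_i^k(1-p_i)^k\right)^{1/m}\le \frac{1}{\sqrt n}\,\frac{\sqrt{m/2}}{\delta^{1/m}}\exp\left(-\frac12+\frac1m\right)+O\left(\frac{1}{n^{\frac12+\frac1m}}\right).$$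
   Context: $\mathbb{N}=\{1,2,\dots\}$. The support of $p$ may be finite or infinite. For a sample $X^n=(X_1,\dots,X_n)$ of i.i.d. draws from $p$, $c_i(X^n)$ is the number of appearances of symbol $i$ and the maximum likelihood estimator (MLE) is $\hat p_i(X^n)=c_i(X^n)/n$, $i\in\mathbb{N}$. The $O(\cdot)$ term is as $n\to\infty$ with $m$ and $\delta$ fixed (implied constant depending only on $m,\delta$). *)

(* Defs.v *)
From mathcomp Require Import all_boot all_order all_algebra.
From mathcomp Require Import all_classical all_reals all_analysis.

Set Implicit Arguments.
Unset Strict Implicit.
Unset Printing Implicit Defensive.

Import Order.TTheory GRing.Theory Num.Theory.
Import numFieldNormedType.Exports.

Local Open Scope classical_set_scope.
Local Open Scope ring_scope.

(* The alphabet is {1, 2, ...}: symbols are the positive elements of nat, every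
   sum and supremum over symbols starts at 1, and p 0 is an unused value. *)

Definition is_distribution (R : realType) (p : nat -> R) : Prop :=
  (forall i, (0 < i)%N -> 0 <= p i) /\
  (\sum_(1 <= i <oo) (p i)%:E = 1)%E.

Definition mutually_independent d d' (T : measurableType d)
    (T' : measurableType d') (R : realType) (P : probability T R)
    (I : finType) (X : I -> {RV P >-> T'}) : Prop :=
  forall (J : {set I}) (A : I -> set T'), (forall j, measurable (A j)) ->
    P (\bigcap_(j in [set` J]) (X j @^-1` A j)) =
    (\prod_(j in J) P (X j @^-1` A j))%E.

(* As p sums to 1 over {1, 2, ...}, the marginal condition forces each
   observation to be a positive integer almost surely. *)
Definition iid_sample d (T : measurableType d) (R : realType)
    (P : probability T R) (p : nat -> R) (n : nat)
    (X : 'I_n -> {RV P >-> nat}) : Prop :=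
  mutually_independent X /\
  (forall j i, (0 < i)%N -> distribution P (X j) [set i] = (p i)%:E).

Definition count_symbol n (x : 'I_n -> nat) (i : nat) : nat :=
  #|[pred j | x j == i]|.

Definition mle (R : realType) n (x : 'I_n -> nat) (i : nat) : R :=
  (count_symbol x i)%:R / n%:R.

Definition sup_dist (R : realType) (p q : nat -> R) : \bar R :=
  ereal_sup [set (`|p i - q i|)%:E | i in [set i | (0 < i)%N]].

(* For k >= 1 the series is nonnegative and dominated by that of p, so fine
   returns its actual value. *)
Definition moment_bound (R : realType) (p : nat -> R) (m n : nat) (delta : R)
    : R :=
  n%:R^-1 * (1 / delta `^ m%:R^-1) *
  \sum_(1 <= k < m./2.+1)
    (k%:R ^+ (m - k) * n%:R ^+ k *
     fine (\sum_(1 <= i <oo) (p i ^+ k * (1 - p i) ^+ k)%:E)%E) `^ m%:R^-1.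

Definition leading_term (R : realType) (m n : nat) (delta : R) : R :=
  1 / Num.sqrt n%:R * (Num.sqrt (m%:R / 2) / delta `^ m%:R^-1) *
  expR (- 2^-1 + m%:R^-1).

(* Main.v *)
Require Import Defs.
From mathcomp Require Import all_boot all_order all_algebra.
From mathcomp Require Import all_classical all_reals all_analysis.
From mathcomp Require Import ring lra zify.

(** Write [m = 2K] and [s_i = n p_i (1 - p_i)].  The number of occurrences of
    symbol [i] is binomial, so the union bound over the symbols, followed by
    Markov's inequality for the [m]-th central moment of each count, shows that
    the first claim holds as soon as
      [sum_i E (c_i - n p_i)^m <= (sum_{k=1}^K t_k)^m]
    with [t_k = (k^(m-k) Q_k)^(1/m)] and [Q_k = sum_i s_i^k].

    Central moments.  Stein's identity for the binomial law expresses a moment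
    through lower ones ([binomial_mean_stein]), and the recursion so obtained
    is dominated by the one that counts the set partitions of [m] points
    without singletons.  Hence
      [E (c_i - n p_i)^m <= sum_{k=1}^K A(m,k) s_i^k],
    where [A(m,k)] is the number of such partitions into [k] blocks
    ([binomial_central_moment_le]).

    From partitions to roots.  It remains to see that
    [sum_k A(m,k) Q_k <= B^m] for [B = sum_k t_k]
    ([sum_assoc_stirling2_le]).  Since [B^m = sum_k t_k B^(m-1)], it is enough
    to compare term by term.  For the extreme indices, [A(m,1) = 1] and
    [A(m,K) = (m-1)!! <= K^K], so that [A(m,k) Q_k <= t_k^m <= t_k B^(m-1)].
    For [1 < k < K], the weight [k^(m-k)] alone may be too small, but then [t_k]
    has two neighbours in the sum: by Cauchy-Schwarz [Q_k^2 <= Q_{k-1} Q_{k+1}],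
    whence [t_k^2 <= 4 t_{k-1} t_{k+1}], [t_k <= t_{k-1} + t_{k+1}] and
    [2 t_k <= B].  So [t_k B^(m-1) >= 2^(m-1) t_k^m], and the factor [2^(m-1)]
    is enough because [A(m,k) <= k^m / k! <= 4^k k^(m-k)] and [2k < m].
    Only the log-convexity of [Q] matters, and power sums have it, so the
    argument runs once for all symbols together.

    Second claim.  From [p (1 - p) <= 1/4] one gets
    [sum_i (p_i (1 - p_i))^k <= 4^-(k-1)].  With [exp 1 <= 4] the summand
    [k = K] is at most the leading term, and a summand [k < K] is of order
    [n^(-1 + k/m)], hence at most of order [n^(-(1/2 + 1/m))]. *)

Set Implicit Arguments.
Unset Strict Implicit.

Import Order.TTheory GRing.Theory Num.Theory.
Import numFieldNormedType.Exports.

Local Open Scope classical_set_scope.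
Local Open Scope ring_scope.

(** * Set partitions without singletons *)

(** The associated Stirling number of the second kind: the number of partitions
    of [m] points into [k] blocks of size at least 2.  The recursion removes
    the block of the last point, [j] being the number of points outside of it;
    it is the one that the central moments produce. *)
Fixpoint assoc_stirling2 (m k : nat) : nat :=
  if k is k'.+1 then
    (\sum_(j < m.-1) 'C(m.-1, j) * assoc_stirling2 j k')%N
  else (m == 0)%N.

Lemma assoc_stirling2_eq0 (k m : nat) :
  (m < k.*2)%N -> assoc_stirling2 m k = 0%N.
Proof.
elim: k m => [|k IHk] m //= hm.
apply: big1 => j _; rewrite IHk ?muln0 //.
by have := ltn_ord j; lia.
Qed.

Lemma assoc_stirling2n1 (m : nat) : (assoc_stirling2 m 1 <= 1)%N.
Proof.
case: m => [|[|m]] /=; rewrite ?big_ord0 //.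
rewrite big_ord_recl /= bin0 big1 // => j _.
by rewrite muln0.
Qed.

(** Only perfect matchings remain, and each step of the recursion contributes a
    factor [2k + 1], for which Bernoulli's inequality suffices:
    [(2k + 1) k^k <= (k + 1)^(k + 1)]. *)
Lemma assoc_stirling2_diag (k : nat) : (assoc_stirling2 k.*2 k <= k ^ k)%N.
Proof.
elim: k => [|k IHk] //.
rewrite doubleS /= big_ord_recr /= big1 => [|j _]; last first.
  by rewrite assoc_stirling2_eq0 ?muln0.
rewrite add0n binSn (leq_trans (leq_mul (leqnn _) IHk)) //.
have bern : (k ^ k.+1 + k.+1 * k ^ k <= k.+1 ^ k.+1)%N.
  rewrite -[X in (_ <= X ^ _)%N]addn1 expnDn big_ord_recl big_ord_recl /=.
  rewrite subn0 bin0 bin1 !exp1n !muln1 mul1n /bump /= subn1 /=.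
  by rewrite addnA leq_addr.
by apply: leq_trans bern; rewrite expnS -mulnDl; apply: leq_mul => //; lia.
Qed.

(** Partitions with labelled blocks are particular maps from [m] points to [k]
    labels. *)
Lemma assoc_stirling2_fact_le (k m : nat) :
  (k`! * assoc_stirling2 m k <= k ^ m)%N.
Proof.
elim: k m => [|k IHk] [|m] //=; first by rewrite big_ord0 muln0.
rewrite factS -mulnA expnS leq_mul // big_distrr /= -add1n expnDn.
rewrite big_ord_recr /= (leq_trans _ (leq_addr _ _)) //.
apply: leq_sum => j _.
by rewrite exp1n mul1n mulnCA leq_mul.
Qed.

Lemma expn_leq_ffact (n k : nat) : ((n - k) ^ k <= n ^_ k)%N.
Proof.
elim: k => [|k IHk] //.
rewrite expnSr ffactnSr leq_mul //; last by lia.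
by apply: leq_trans IHk; case: k => // k; rewrite leq_exp2r //; lia.
Qed.

(** Elementary substitute for [k^k / k! <= exp k]: [k^k] is at most the falling
    factorial of [2k] of length [k], which is ['C(2k, k) k!]. *)
Lemma expnn_leq_fact (k : nat) : (k ^ k <= 4 ^ k * k`!)%N.
Proof.
have -> : (k ^ k = (k.*2 - k) ^ k)%N by congr (_ ^ _)%N; lia.
rewrite (leq_trans (expn_leq_ffact _ _)) // -bin_ffact leq_mul //.
rewrite -[4%N]/(2 ^ 2)%N -expnM mul2n -[X in (_ <= X ^ _)%N]/(1 + 1)%N expnDn.
have kle : (k < k.*2.+1)%N by lia.
rewrite (bigD1 (Ordinal kle)) //= !exp1n !muln1.
exact: leq_addr.
Qed.

(** The bound for the inner indices; the factor [2^(m-1)] is what the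
    neighbouring summands provide in [sum_assoc_stirling2_le]. *)
Lemma assoc_stirling2_le (m k : nat) : (0 < k)%N -> (k.*2 < m)%N ->
  (assoc_stirling2 m k <= 2 ^ m.-1 * k ^ (m - k))%N.
Proof.
move=> k_gt0 km; rewrite -(leq_pmul2l (fact_gt0 k)).
rewrite (leq_trans (assoc_stirling2_fact_le _ _)) //.
have -> : (k ^ m = k ^ k * k ^ (m - k))%N by rewrite -expnD; congr (_ ^ _)%N; lia.
rewrite mulnA leq_mul // (leq_trans (expnn_leq_fact _)) // mulnC leq_mul //.
by rewrite -[4%N]/(2 ^ 2)%N -expnM leq_exp2l //; lia.
Qed.

(** * Central moments of the binomial law *)

Section BinomialMean.
Variable R : realType.
Implicit Types (p : R) (g : nat -> R).

Definition binomial_mean (n : nat) p g : R :=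
  \sum_(k < n.+1) 'C(n, k)%:R * p ^+ k * (1 - p) ^+ (n - k) * g k.

Lemma eq_binomial_mean n p g1 g2 : g1 =1 g2 ->
  binomial_mean n p g1 = binomial_mean n p g2.
Proof. by move=> g12; apply: eq_bigr => k _; rewrite g12. Qed.

Lemma binomial_mean_lin n p (a : R) g1 g2 :
  binomial_mean n p (fun k => a * g1 k + g2 k) =
  a * binomial_mean n p g1 + binomial_mean n p g2.
Proof.
rewrite /binomial_mean big_distrr -big_split /=; apply: eq_bigr => k _.
by ring.
Qed.

Lemma binomial_mean_sum n p I (r : seq I) (g : I -> nat -> R) :
  binomial_mean n p (fun k => \sum_(i <- r) g i k) =
  \sum_(i <- r) binomial_mean n p (g i).
Proof.
rewrite /binomial_mean exchange_big /=; apply: eq_bigr => k _.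
by rewrite big_distrr.
Qed.

Lemma binomial_mean1 n p : binomial_mean n p (fun=> 1) = 1.
Proof.
have := exprDn (1 - p) p n; rewrite subrK expr1n => E; rewrite [RHS]E.
by apply: eq_bigr => k _; rewrite -mulr_natl; ring.
Qed.

Lemma binomial_meanS n p g :
  binomial_mean n.+1 p g =
  p * binomial_mean n p (g \o succn) + (1 - p) * binomial_mean n p g.
Proof.
rewrite /binomial_mean big_ord_recl /= bin0 expr0 subn0.
under eq_bigr => k _ do rewrite /bump /= add1n binS natrD subSS.
under eq_bigr => k _ do rewrite !mulrDl.
rewrite big_split /= addrA addrC; congr (_ + _).
  by rewrite big_distrr /=; apply: eq_bigr => k _; rewrite exprS; ring.
rewrite big_ord_recr /= bin_small // !mul0r addr0 big_ord_recl /= bin0 subn0.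
rewrite mulrDr expr0; congr (_ + _); first by rewrite exprS; ring.
rewrite big_distrr /=; apply: eq_bigr => k _; rewrite /bump /= add1n.
have -> : (n - k)%N = (n - k.+1).+1 by have := ltn_ord k; lia.
by rewrite !exprS; ring.
Qed.

(** Size biasing: weighting the law of [n + 1] trials by the number of successes
    amounts to imposing one success. *)
Lemma binomial_mean_size_bias n p g :
  binomial_mean n.+1 p (fun k => k%:R * g k) =
  n.+1%:R * p * binomial_mean n p (g \o succn).
Proof.
rewrite /binomial_mean big_ord_recl /= mul0r mulr0 add0r big_distrr /=.
apply: eq_bigr => k _; rewrite /bump /= add1n subSS.
have := mul_bin_diag n.+1 k; rewrite /= => /(congr1 (GRing.natmul (1 : R))).
rewrite !natrM exprS => E.
transitivity ((k.+1%:R * 'C(n.+1, k.+1)%:R) *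
  (p * p ^+ k * (1 - p) ^+ (n - k) * g k.+1)); first by ring.
by rewrite -E; ring.
Qed.

(** Stein's identity: with [g] a power of the centred variable, the difference
    on the right only involves lower powers. *)
Lemma binomial_mean_stein n p g :
  binomial_mean n.+1 p (fun k => (k%:R - n.+1%:R * p) * g k) =
  n.+1%:R * (p * (1 - p)) * binomial_mean n p (fun k => g k.+1 - g k).
Proof.
under eq_binomial_mean => k do rewrite mulrBl addrC -mulNr.
rewrite binomial_mean_lin binomial_mean_size_bias binomial_meanS.
under [in RHS]eq_binomial_mean => k do rewrite addrC -mulN1r.
by rewrite binomial_mean_lin /comp; ring.
Qed.

Lemma norm_expr_diff_le1 p j : 0 <= p <= 1 -> `|(1 - p) ^+ j.+1 - (- p) ^+ j.+1| <= 1.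
Proof.
move=> /andP[p0 p1]; have q0 : 0 <= 1 - p by lra.
rewrite (le_trans (ler_normB _ _)) // !normrX normrN !ger0_norm //.
rewrite -[leRHS](subrK p).
by apply: lerD; rewrite exprS ler_piMr // exprn_ile1 //; lra.
Qed.

(** In Stein's identity [g (k+1) - g k] expands, by the binomial formula around
    the mean of the remaining [n] trials, into lower central moments with
    coefficients ['C(m, j)] times a factor of absolute value at most 1.  This
    is the recursion of [assoc_stirling2], each step of which contributes a
    factor [n p (1 - p)]. *)
Lemma binomial_central_moment_le (m n N : nat) p :
  0 <= p <= 1 -> (m < N.*2)%N ->
  `|binomial_mean n p (fun k => (k%:R - n%:R * p) ^+ m)|
    <= \sum_(k < N) (assoc_stirling2 m k)%:R * (n%:R * (p * (1 - p))) ^+ k.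
Proof.
move=> p01; have pq0 : 0 <= p * (1 - p) by case/andP: p01 => ? ?; apply: mulr_ge0; lra.
elim/ltn_ind: m n N => -[|m] IHm n [|N] // mN.
  under eq_binomial_mean => k do rewrite expr0.
  rewrite binomial_mean1 normr1 big_ord_recl /= expr0 mulr1 lerDl.
  by apply: sumr_ge0 => k _; rewrite mulr_ge0 // exprn_ge0 // mulr_ge0.
case: n => [|n].
  rewrite /binomial_mean big_ord1 mul0r subrr expr0n mulr0 normr0.
  by apply: sumr_ge0 => k _; rewrite mulr_ge0 // exprn_ge0 // mul0r.
under eq_binomial_mean => k do rewrite exprS.
rewrite binomial_mean_stein.
set s := n.+1%:R * _; have s0 : 0 <= s by rewrite mulr_ge0.
have step k : (k.+1%:R - n.+1%:R * p) ^+ m - (k%:R - n.+1%:R * p) ^+ m =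
  \sum_(j < m) ('C(m, j)%:R * ((1 - p) ^+ (m - j) - (- p) ^+ (m - j)))
    * (k%:R - n%:R * p) ^+ j.
  have -> : k.+1%:R - n.+1%:R * p = (1 - p) + (k%:R - n%:R * p) by rewrite -!natr1; ring.
  have -> : k%:R - n.+1%:R * p = (- p) + (k%:R - n%:R * p) by rewrite -!natr1; ring.
  rewrite !exprDn -sumrB big_ord_recr /= subnn !expr0 subrr addr0.
  by apply: eq_bigr => j _; rewrite -!(mulr_natl (_ * _)); ring.
under eq_binomial_mean => k do rewrite step.
rewrite binomial_mean_sum normrM ger0_norm //.
have -> : \sum_(k < N.+1) (assoc_stirling2 m.+1 k)%:R * s ^+ k =
   s * \sum_(j < m) 'C(m, j)%:R * \sum_(k < N) (assoc_stirling2 j k)%:R * s ^+ k.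
  rewrite big_ord_recl /= mul0r add0r.
  under eq_bigr => k _ do rewrite /bump /= add1n natr_sum big_distrl /=.
  rewrite exchange_big big_distrr /=; apply: eq_bigr => j _.
  rewrite !big_distrr /=; apply: eq_bigr => k _.
  by rewrite natrM exprS; ring.
apply: ler_wpM2l => //; apply: le_trans (ler_norm_sum _ _ _) _.
apply: ler_sum => j _.
have := binomial_mean_lin n p ('C(m, j)%:R * ((1 - p) ^+ (m - j) - (- p) ^+ (m - j)))
  (fun k => (k%:R - n%:R * p) ^+ j) (fun=> 0).
have -> : binomial_mean n p (fun=> 0) = 0 by apply: big1 => k _; rewrite mulr0.
under eq_binomial_mean => k do rewrite addr0.
rewrite addr0 => ->.
rewrite !normrM -mulrA normr_nat ler_wpM2l // -[leRHS]mul1r ler_pM //.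
  have -> : (m - j)%N = (m - j).-1.+1 by have := ltn_ord j; lia.
  exact: norm_expr_diff_le1.
have jm := ltn_ord j.
apply: le_trans (IHm _ _ n N _) _ => //; [by lia|by lia|].
apply: ler_sum => k _; rewrite ler_wpM2l // lerXn2r ?nnegrE ?(mulr_ge0 _ pq0) //.
by rewrite /s ler_wpM2r // ler_nat.
Qed.

End BinomialMean.

(** * From partition numbers to m-th roots *)

(** The factors [(k-1)(k+1)] and [k^2] pair up [m - k - 1] times, each pair
    costing at most a factor 4; the remaining [4^(k+1)] pays for the factors
    left over. *)
Lemma weight_log_concave (k m : nat) : (1 < k)%N -> (k < m)%N ->
  (k ^ (m - k) * k ^ (m - k)
    <= 4 ^ m * (k.-1 ^ (m - k.-1) * k.+1 ^ (m - k.+1)))%N.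
Proof.
case: k => [|[|k]] // _ km; rewrite /=.
have [e ->] : exists e, m = (k.+3 + e)%N by exists (m - k.+3)%N; lia.
have -> : (k.+3 + e - k.+2 = e.+1)%N by lia.
have -> : (k.+3 + e - k.+1 = e.+2)%N by lia.
have -> : (k.+3 + e - k.+3 = e)%N by lia.
have -> : (4 ^ (k.+3 + e) * (k.+1 ^ e.+2 * k.+3 ^ e) =
   (4 ^ k.+3 * (k.+1 * k.+1)) * (4 * k.+1 * k.+3) ^ e)%N.
  by rewrite expnD !expnMn !(expnS k.+1); ring.
have -> : (k.+2 ^ e.+1 * k.+2 ^ e.+1 = (k.+2 * k.+2) * (k.+2 * k.+2) ^ e)%N.
  by rewrite !expnMn !expnS; ring.
apply: leq_mul.
  have : (4 * (k.+1 * k.+1) <= 4 ^ k.+3 * (k.+1 * k.+1))%N.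
    by rewrite leq_mul // -{1}[4%N]expn1 leq_exp2l.
  apply: leq_trans; nia.
case: e {km} => // e; rewrite leq_exp2r //; nia.
Qed.

Section PowerSums.
Variable R : realType.

(** Cauchy-Schwarz for the vectors [x_i^(k/2)] and [x_i^(k/2 + 1)], by the
    discriminant of a nonnegative quadratic form. *)
Lemma sum_expr_log_convex (I : Type) (r : seq I) (x : I -> R) (k : nat) :
  (forall i, 0 <= x i) ->
  (\sum_(i <- r) x i ^+ k.+1) ^+ 2
    <= (\sum_(i <- r) x i ^+ k) * (\sum_(i <- r) x i ^+ k.+2).
Proof.
move=> x0.
set a := \sum_(i <- r) x i ^+ k; set b := \sum_(i <- r) _; set c := \sum_(i <- r) _.
have quad (u v : R) : 0 <= u ^+ 2 * c - 2 * u * v * b + v ^+ 2 * a.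
  have -> : u ^+ 2 * c - 2 * u * v * b + v ^+ 2 * a =
      \sum_(i <- r) x i ^+ k * (u * x i - v) ^+ 2.
    rewrite /a /b /c !big_distrr /= -sumrB -big_split /=.
    by apply: eq_bigr => i _; rewrite !exprS; ring.
  by apply: sumr_ge0 => i _; rewrite mulr_ge0 ?sqr_ge0 ?exprn_ge0.
have c0 : 0 <= c by apply: sumr_ge0 => i _; rewrite exprn_ge0.
have := c0; rewrite le_eqVlt => /predU1P[cE|c_gt0].
  rewrite -cE mulr0; have [->|b0] := eqVneq b 0; first by rewrite expr0n.
  (* At this point the form, affine in its first argument, equals -1. *)
  have := quad ((a + 1) / (2 * b)) 1; rewrite -cE.
  have -> : ((a + 1) / (2 * b)) ^+ 2 * 0 - 2 * ((a + 1) / (2 * b)) * 1 * b + 1 ^+ 2 * a = -1.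
    by field.
  by rewrite ler0N1.
rewrite -(ler_pM2l c_gt0) -subr_ge0.
by apply: le_trans (quad b c) _; rewrite le_eqVlt; apply/orP; left; apply/eqP; ring.
Qed.

(** The heart of the proof.  Let [t_k] be the summands on the right and [B] their
    sum, so that the right-hand side is [sum_k t_k B^(m-1)]; the comparison is
    then made for each [k].  At both ends [t_k <= B] is enough.  In between,
    log-convexity of [Q] gives [t_k^2 <= 4 t_(k-1) t_(k+1)], so the neighbours
    add up to at least [t_k] and [2 t_k <= B]. *)
Lemma sum_assoc_stirling2_le (K : nat) (Q : nat -> R) (K_gt0 : (0 < K)%N) :
  (forall k, 0 <= Q k) ->
  (forall k, (1 < k < K)%N -> Q k ^+ 2 <= Q k.-1 * Q k.+1) ->
  \sum_(1 <= k < K.+1) (assoc_stirling2 K.*2 k)%:R * Q k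
   <= (\sum_(1 <= k < K.+1) (k%:R ^+ (K.*2 - k) * Q k) `^ K.*2%:R^-1) ^+ K.*2.
Proof.
move=> Q0 Qlc; set m := K.*2; pose t := fun k : nat => (k%:R ^+ (m - k) * Q k) `^ m%:R^-1.
pose B := \sum_(1 <= k < K.+1) t k.
rewrite -[leRHS]/(B ^+ m).
have m_gt0 : (0 < m)%N by rewrite /m; lia.
have t0 k : 0 <= t k by exact: powR_ge0.
have tm k : t k ^+ m = k%:R ^+ (m - k) * Q k.
  rewrite -powR_mulrn // /t -powRrM mulVf ?pnatr_eq0 -?lt0n // powRr1 //.
  by rewrite mulr_ge0 // exprn_ge0.
have B0 : 0 <= B by apply: sumr_ge0.
have tB k : (0 < k <= K)%N -> t k <= B.
  move=> kK; rewrite /B (bigD1_seq k) ?iota_uniq ?mem_index_iota //=.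
  by rewrite lerDl sumr_ge0.
have tlc k : (1 < k < K)%N -> t k <= t k.-1 + t k.+1.
  move=> kK.
  have : t k ^+ 2 <= 4 * (t k.-1 * t k.+1).
    rewrite -(@ler_pXn2r _ m) ?nnegrE ?mulr_ge0 ?exprn_ge0 //.
    rewrite -exprM mulnC exprM tm !exprMn !tm.
    rewrite [X in _ <= _ * X]mulrACA [leRHS]mulrA -!natrX -!natrM.
    rewrite ler_pM ?ler_nat ?mulr_ge0 ?sqr_ge0 ?Qlc ?exprn_ge0 //.
    by rewrite -expnM muln2 -addnn expnD weight_log_concave //; rewrite /m; lia.
  have := t0 k; have := t0 k.-1; have := t0 k.+1.
  move: (t k) (t k.-1) (t k.+1) => x y z z0 y0 x0 xyz.
  rewrite -(@ler_pXn2r _ 2) ?nnegrE ?addr_ge0 //.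
  by have := sqr_ge0 (y - z); nra.
have tB2 k : (1 < k < K)%N -> 2 * t k <= B.
  case: k => [|[|k]] // kK; have := tlc _ kK => /= le3.
  rewrite /B (@big_cat_nat _ _ _ k.+1) /=; [|by lia|by lia].
  rewrite (@big_ltn _ _ _ k.+1); last by lia.
  rewrite (@big_ltn _ _ _ k.+2); last by lia.
  rewrite (@big_ltn _ _ _ k.+3); last by lia.
  have : 0 <= \sum_(1 <= i < k.+1) t i by apply: sumr_ge0.
  have : 0 <= \sum_(k.+4 <= i < K.+1) t i by apply: sumr_ge0.
  by lra.
have -> : B ^+ m = \sum_(1 <= k < K.+1) t k * B ^+ m.-1.
  by rewrite -big_distrl /= -exprS prednK.
have tmB k : (0 < k <= K)%N -> t k ^+ m <= t k * B ^+ m.-1.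
  by move=> kK; rewrite -{1}(prednK m_gt0) exprS ler_wpM2l // lerXn2r ?nnegrE ?tB.
apply: ler_sum_nat => k /andP[k1 kK].
have [->|kneqK] := eqVneq k K.
  apply: le_trans (tmB K _); last by lia.
  rewrite tm /m -addnn addnK addnn ler_wpM2r // -natrX ler_nat.
  exact: assoc_stirling2_diag.
have [->|kneq1] := eqVneq k 1%N.
  apply: le_trans (tmB 1%N _); last by lia.
  by rewrite tm expr1n ler_wpM2r //; have := assoc_stirling2n1 m; rewrite -(ler_nat R).
have kK2 : (1 < k < K)%N by lia.
apply: (@le_trans _ _ (2 ^+ m.-1 * t k ^+ m)).
  rewrite tm mulrA ler_wpM2r // -!natrX -natrM ler_nat.
  by apply: assoc_stirling2_le => //; rewrite /m; lia.
rewrite -{2}(prednK m_gt0) exprS mulrCA -exprMn ler_wpM2l // lerXn2r ?nnegrE ?tB2 //.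
by rewrite mulr_ge0.
Qed.

(** Summing over the symbols before taking roots avoids Minkowski's inequality:
    the power sums of the variances are log-convex themselves. *)
Lemma sum_binomial_central_moment_le (K n : nat) (p : nat -> R) (N : nat) :
  (0 < K)%N -> (forall i, (0 < i)%N -> 0 <= p i <= 1) ->
  \sum_(1 <= i < N)
     binomial_mean n (p i) (fun k => (k%:R - n%:R * p i) ^+ K.*2)
   <= (\sum_(1 <= k < K.+1) (k%:R ^+ (K.*2 - k) * (n%:R ^+ k *
        \sum_(1 <= i < N) (p i * (1 - p i)) ^+ k)) `^ K.*2%:R^-1) ^+ K.*2.
Proof.
move=> K_gt0 p01.
(* The value at 0 is arbitrary; 0 makes all the [x i] nonnegative. *)
pose x i := if (0 < i)%N then n%:R * (p i * (1 - p i)) else 0.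
have x0 i : 0 <= x i.
  rewrite /x; case: ifP => // i0; have /andP[? ?] := p01 _ i0.
  by rewrite !mulr_ge0 // subr_ge0.
have QE k : n%:R ^+ k * \sum_(1 <= i < N) (p i * (1 - p i)) ^+ k =
    \sum_(1 <= i < N) x i ^+ k.
  rewrite big_distrr /=; apply: eq_big_nat => i /andP[i0 _].
  by rewrite /x i0 -exprMn.
under [X in _ <= X ^+ _]eq_bigr => k _ do rewrite QE.
apply: le_trans (@sum_assoc_stirling2_le K _ K_gt0 _ _); last 2 first.
- by move=> k; apply: sumr_ge0 => i _; rewrite exprn_ge0.
- by case=> [|k] // _; apply: sum_expr_log_convex.
under [leRHS]eq_bigr => k _ do rewrite big_distrr /=.
rewrite [leRHS]exchange_big /=; apply: ler_sum_nat => i /andP[i0 _].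
have := @binomial_central_moment_le R K.*2 n K.+1 (p i) (p01 _ i0).
rewrite ltn_double => /(_ (ltnSn _)) /(le_trans (ler_norm _)) /le_trans; apply.
rewrite -(big_mkord xpredT
  (fun k => (assoc_stirling2 K.*2 k)%:R * (n%:R * (p i * (1 - p i))) ^+ k)).
rewrite big_ltn //.
rewrite [assoc_stirling2 _ _]/= double_eq0 -leqn0 leqNgt K_gt0 mul0r add0r.
by rewrite /x i0.
Qed.

End PowerSums.

(** * The law of a symbol count *)

Lemma sum_powerset_card (R : realType) (n : nat) (F : nat -> R) :
  \sum_(J : {set 'I_n}) F #|J| = \sum_(k < n.+1) 'C(n, k)%:R * F k.
Proof.
have cardJ (J : {set 'I_n}) : (#|J| < n.+1)%N.
  by rewrite ltnS -[X in (_ <= X)%N]card_ord max_card.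
rewrite (partition_big (fun J => Ordinal (cardJ J)) xpredT) //=.
apply: eq_bigr => k _.
rewrite (eq_bigr (fun=> F k)) => [|J /eqP <-] //.
rewrite sumr_const -[LHS]mulr_natl; congr (GRing.natmul 1 _ * _).
have := card_draws 'I_n k; rewrite card_ord cardsE => <-.
by apply: eq_card => J.
Qed.

Section Sample.
Context d (T : measurableType d) (R : realType) (P : probability T R).
Variables (p : nat -> R) (n : nat) (X : 'I_n -> {RV P >-> nat}).
Hypothesis Xiid : iid_sample p X.
Variable i : nat.
Hypothesis i_gt0 : (0 < i)%N.

(** Prescribing all the positions of symbol [i], rather than their number, gives
    an event with one condition per draw, to which independence applies. *)
Definition occurrences (J : {set 'I_n}) : set T :=
  \bigcap_(j in [set` [set: 'I_n]%SET])
    (X j @^-1` (if j \in J then [set i] else ~` [set i])).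

Lemma measurable_occurrences J : measurable (occurrences J).
Proof.
apply: fin_bigcap_measurable => // j _.
by apply: measurable_funPTI; case: ifP.
Qed.

Lemma probability_occurrences J :
  P (occurrences J) = (p i ^+ #|J| * (1 - p i) ^+ (n - #|J|))%:E.
Proof.
case: Xiid => indep marg.
have Pi j : P (X j @^-1` [set i]) = (p i)%:E by rewrite -(marg j _ i_gt0).
rewrite /occurrences (indep [set: 'I_n]%SET
  (fun j => if j \in J then [set i] else ~` [set i])); last first.
  by move=> j; case: ifP.
rewrite (eq_bigr (fun j => (if j \in J then p i else 1 - p i)%:E)); last first.
  move=> j _; case: ifP => // _.
  rewrite -preimage_setC probability_setC; last exact: measurable_funPTI.
  by rewrite Pi.
rewrite prodEFin; congr (_%:E).
rewrite (bigID (mem J)) /=.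
rewrite (eq_bigr (fun=> p i)) => [|j /andP[_ ->]] //.
rewrite [X in _ * X](eq_bigr (fun=> 1 - p i)) => [|j /andP[_ /negbTE ->]] //.
rewrite !prodr_const; congr (_ ^+ _ * _ ^+ _).
  by apply: eq_card => j; rewrite unfold_in /= inE.
have := cardsCs (~: J)%SET; rewrite finset.setCK card_ord => <-.
by apply: eq_card => j; rewrite [LHS]unfold_in /= !inE.
Qed.

Lemma count_symbolE J w : occurrences J w -> count_symbol (fun j => X j w) i = #|J|.
Proof.
move=> JE; apply: eq_card => j; rewrite !inE.
have := JE j; rewrite /= inE => /(_ isT).
by case: ifP => _ /= => [->|/eqP/negbTE]; rewrite ?eqxx.
Qed.

Lemma count_symbol_preimage (D : pred nat) :
  [set w | D (count_symbol (fun j => X j w) i)] =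
  \big[setU/set0]_(J : {set 'I_n} | D #|J|) occurrences J.
Proof.
rewrite -[RHS]/(\big[setU/set0]_(J in [pred J : {set 'I_n} | D #|J|]) occurrences J).
rewrite -bigcup_pred; apply/seteqP; split => w /=; last first.
  by case=> J /=; rewrite inE => DJ /count_symbolE ->.
move=> Dw; exists [set j | X j w == i]%SET.
  by rewrite /= inE cardsE.
move=> j _ /=; rewrite inE; case: ifP => /eqP //.
Qed.

Lemma measurable_count_symbol (D : pred nat) :
  measurable [set w | D (count_symbol (fun j => X j w) i)].
Proof.
rewrite count_symbol_preimage; apply: bigsetU_measurable => J _.
exact: measurable_occurrences.
Qed.

Lemma probability_count_symbol_le (D : pred nat) :
  (P [set w | D (count_symbol (fun j => X j w) i)] <=
   (binomial_mean n (p i) (fun k => (D k)%:R))%:E)%E.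
Proof.
have -> : binomial_mean n (p i) (fun k => (D k)%:R) =
    \sum_(J : {set 'I_n} | D #|J|) p i ^+ #|J| * (1 - p i) ^+ (n - #|J|).
  rewrite big_mkcond /=.
  pose F k := p i ^+ k * (1 - p i) ^+ (n - k) * (D k)%:R.
  transitivity (\sum_(J : {set 'I_n}) F #|J|); last first.
    by apply: eq_bigr => J _; rewrite /F; case: ifP => _; rewrite ?mulr1 ?mulr0.
  by rewrite sum_powerset_card; apply: eq_bigr => k _; rewrite /F !mulrA.
rewrite -sumEFin count_symbol_preimage.
under [leRHS]eq_bigr => J _ do rewrite -probability_occurrences.
set U := \big[_/_]_(_ | _) occurrences _.
suff [] : measurable U /\ (P U <= \sum_(J : {set 'I_n} | D #|J|) P (occurrences J))%E by [].
rewrite /U; elim/big_rec2: _ => [|J x B _ [mB BA]]; rewrite ?measure0 //.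
have mJ := measurable_occurrences J.
split; first exact: measurableU.
by apply: le_trans (leeD2l _ BA); exact: measureU2.
Qed.

End Sample.

Section BinomialTail.
Variable R : realType.

Lemma binomial_mean_markov (n : nat) (p a : R) (f : nat -> R) :
  0 <= p <= 1 -> 0 <= a -> (forall k, 0 <= f k) ->
  a * binomial_mean n p (fun k => (a < f k)%R%:R) <= binomial_mean n p f.
Proof.
move=> /andP[p0 p1] a0 f0; have q0 : 0 <= 1 - p by rewrite subr_ge0.
rewrite /binomial_mean big_distrr /=; apply: ler_sum => k _.
rewrite mulrCA ler_wpM2l ?mulr_ge0 ?exprn_ge0 //.
by case: ltP => [/ltW|_]; rewrite ?mulr1 ?mulr0.
Qed.

Lemma binomial_mean_ge0 (n : nat) (p : R) (f : nat -> R) :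
  0 <= p <= 1 -> (forall k, 0 <= f k) -> 0 <= binomial_mean n p f.
Proof.
move=> /andP[p0 p1] f0; have q0 : 0 <= 1 - p by rewrite subr_ge0.
by apply: sumr_ge0 => k _; rewrite !mulr_ge0 ?exprn_ge0.
Qed.

(** Replaces Markov's inequality at threshold 0, where that inequality is
    void. *)
Lemma binomial_mean_support_eq0 (n : nat) (p : R) (f : nat -> R) :
  0 <= p <= 1 -> (forall k, 0 <= f k) -> binomial_mean n p f = 0 ->
  binomial_mean n p (fun k => (0 < f k)%R%:R) = 0.
Proof.
move=> /andP[p0 p1] f0 fE; have q0 : 0 <= 1 - p by rewrite subr_ge0.
apply: big1 => k _; case: ltgtP (f0 k) => [fk _|//|_ _]; last by rewrite mulr0.
have w0 : forall j : 'I_n.+1, true ->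
    0 <= 'C(n, j)%:R * p ^+ j * (1 - p) ^+ (n - j) * f j.
  by move=> j _; rewrite !mulr_ge0 ?exprn_ge0.
have /eqP := psumr_eq0P w0 fE (erefl true) (i := k).
by rewrite mulf_eq0 (gt_eqF fk) orbF mulr1 => /eqP.
Qed.

End BinomialTail.

(** * Series over the alphabet *)

Lemma nneseries_ge1_le (R : realType) (f : nat -> R) (c : R) :
  (forall i, (0 < i)%N -> 0 <= f i) ->
  (forall N, \sum_(1 <= i < N) f i <= c) ->
  (\sum_(1 <= i <oo) (f i)%:E <= c%:E)%E.
Proof.
move=> f0 fc; apply: lime_le.
  by apply: is_cvg_nneseries_cond => i i0 _; rewrite lee_fin f0.
by apply: nearW => N; rewrite sumEFin lee_fin.
Qed.

Lemma sum_le_nneseries_ge1 (R : realType) (f : nat -> R) (N : nat) :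
  (forall i, (0 < i)%N -> 0 <= f i) ->
  ((\sum_(1 <= i < N) f i)%:E <= \sum_(1 <= i <oo) (f i)%:E)%E.
Proof.
move=> f0; rewrite -sumEFin; apply: nneseries_lim_ge => i i0 _.
by rewrite lee_fin f0.
Qed.

Section Distribution.
Variables (R : realType) (p : nat -> R).
Hypothesis pdist : is_distribution p.

Lemma distribution_sum_le1 (N : nat) : \sum_(1 <= i < N) p i <= 1.
Proof.
case: pdist => p0 p1; rewrite -lee_fin -p1; exact: sum_le_nneseries_ge1.
Qed.

Lemma distribution_in01 (i : nat) : (0 < i)%N -> 0 <= p i <= 1.
Proof.
move=> i0; have [p0 _] := pdist; rewrite p0 //=.
apply: le_trans (distribution_sum_le1 i.+1).
rewrite big_nat_recr //= lerDr big_nat; apply: sumr_ge0 => j /andP[j0 _]; exact: p0.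
Qed.

Lemma dominated_series (f : nat -> R) (c : R) : 0 <= c ->
  (forall i, (0 < i)%N -> 0 <= f i <= c * p i) ->
  (forall N, \sum_(1 <= i < N) f i <= fine (\sum_(1 <= i <oo) (f i)%:E)%E) /\
  fine (\sum_(1 <= i <oo) (f i)%:E)%E <= c.
Proof.
move=> c0 fp.
have f0 i : (0 < i)%N -> 0 <= f i by move=> /fp /andP[].
have le_c : (\sum_(1 <= i <oo) (f i)%:E <= c%:E)%E.
  apply: nneseries_ge1_le => // N.
  apply: (@le_trans _ _ (c * \sum_(1 <= i < N) p i)).
    rewrite big_distrr /=; apply: ler_sum_nat => i /andP[i0 _].
    by case/andP: (fp i i0).
  by rewrite ler_piMr // distribution_sum_le1.
have fin : (\sum_(1 <= i <oo) (f i)%:E)%E \is a fin_num.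
  rewrite ge0_fin_numE; first exact: le_lt_trans le_c (ltry _).
  by apply: nneseries_ge0 => i i0 _; rewrite lee_fin f0.
split; last by rewrite -lee_fin fineK.
by move=> N; rewrite -lee_fin fineK // sum_le_nneseries_ge1.
Qed.

(** Both bounds come from [(p q)^k <= 4^-(k-1) p], which makes the series
    dominated by that of [p]. *)
Lemma series_pq (k : nat) : (0 < k)%N ->
  (forall N, \sum_(1 <= i < N) (p i * (1 - p i)) ^+ k <=
    fine (\sum_(1 <= i <oo) (p i ^+ k * (1 - p i) ^+ k)%:E)%E) /\
  fine (\sum_(1 <= i <oo) (p i ^+ k * (1 - p i) ^+ k)%:E)%E <= 4^-1 ^+ k.-1.
Proof.
move=> k0.
have [] := @dominated_series (fun i => p i ^+ k * (1 - p i) ^+ k) (4^-1 ^+ k.-1).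
- by rewrite exprn_ge0.
- move=> i i0; have /andP[pi0 pi1] := distribution_in01 i0.
  have q0 : 0 <= 1 - p i by rewrite subr_ge0.
  have pq : p i * (1 - p i) <= 4^-1 by have := sqr_ge0 (p i - 2^-1); nra.
  rewrite mulr_ge0 ?exprn_ge0 //= -exprMn -[X in _ ^+ X](prednK k0) exprSr.
  rewrite ler_pM ?mulr_ge0 ?exprn_ge0 ?mulr_ge0 //; first by rewrite lerXn2r ?nnegrE ?mulr_ge0.
  by rewrite ler_piMr // gerBl.
move=> H1 H2; split=> // N; apply: le_trans (H1 N).
by apply: ler_sum => i _; rewrite exprMn.
Qed.

End Distribution.

(** * The deviation bound *)

Section Bounds.
Variable R : realType.

Lemma powR_invn_exprn (m : nat) (x : R) : (0 < m)%N -> 0 <= x ->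
  (x `^ m%:R^-1) ^+ m = x.
Proof.
move=> m0 x0.
by rewrite -powR_mulrn ?powR_ge0 // -powRrM mulVf ?pnatr_eq0 -?lt0n // powRr1.
Qed.

Lemma powR_invn_le (m : nat) (x y : R) : (0 < m)%N -> 0 <= x -> 0 <= y ->
  x <= y ^+ m -> x `^ m%:R^-1 <= y.
Proof.
move=> m0 x0 y0 xy.
by rewrite -(@ler_pXn2r _ m) ?nnegrE ?powR_ge0 // powR_invn_exprn.
Qed.

(** The factor of [moment_bound] that bounds the [m]-th moment norm of the
    vector of centred counts. *)
Definition root_sum (p : nat -> R) (m n : nat) : R :=
  \sum_(1 <= k < m./2.+1)
    (k%:R ^+ (m - k) * n%:R ^+ k *
     fine (\sum_(1 <= i <oo) (p i ^+ k * (1 - p i) ^+ k)%:E)%E) `^ m%:R^-1.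

Lemma sum_central_moment_le (p : nat -> R) (m n N : nat) :
  is_distribution p -> (0 < m)%N -> ~~ odd m ->
  \sum_(1 <= i < N) binomial_mean n (p i) (fun k => (k%:R - n%:R * p i) ^+ m)
   <= root_sum p m n ^+ m.
Proof.
move=> pd m0 m_even; have mK := even_halfK m_even.
have K0 : (0 < m./2)%N by lia.
have p01 := @distribution_in01 R p pd.
have := @sum_binomial_central_moment_le R m./2 n p N K0 p01; rewrite mK.
move=> /le_trans; apply.
have norm_ge0 F : 0 <= \sum_(1 <= k < m./2.+1) (F k : R) `^ m%:R^-1.
  by apply: sumr_ge0 => k _; exact: powR_ge0.
rewrite lerXn2r ?nnegrE ?norm_ge0 //.
apply: ler_sum_nat => k /andP[k0 _].
have [le1 _] := @series_pq R p pd k k0.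
have sum0 : 0 <= \sum_(1 <= i < N) (p i * (1 - p i)) ^+ k.
  rewrite big_nat; apply: sumr_ge0 => i /andP[i0 _].
  by have /andP[? ?] := p01 i i0; rewrite exprn_ge0 // mulr_ge0 // subr_ge0.
rewrite mulrA ge0_ler_powR ?invr_ge0 ?nnegrE ?mulr_ge0 ?exprn_ge0 //.
  exact: le_trans (le1 N).
by rewrite ler_wpM2l // mulr_ge0 ?exprn_ge0.
Qed.

Lemma moment_bound_expr (p : nat -> R) (m n : nat) (delta : R) :
  (0 < m)%N -> 0 < delta -> (0 < n)%N ->
  delta * (n%:R * moment_bound p m n delta) ^+ m = root_sum p m n ^+ m.
Proof.
move=> m0 d0 n0.
have -> : n%:R * moment_bound p m n delta = root_sum p m n / delta `^ m%:R^-1.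
  rewrite /moment_bound -/(root_sum p m n) mul1r -!mulrA mulVKf ?pnatr_eq0 -?lt0n //.
  exact: mulrC.
by rewrite exprMn exprVn powR_invn_exprn ?ltW // mulrC mulfVK ?gt_eqF.
Qed.

Section Deviation.
Variables (p : nat -> R) (m n : nat) (delta : R).
Hypotheses (pd : is_distribution p) (m_gt0 : (0 < m)%N) (m_even : ~~ odd m)
  (delta_gt0 : 0 < delta) (n_gt0 : (0 < n)%N).

Let a : R := (n%:R * moment_bound p m n delta) ^+ m.

(** Markov's inequality for each symbol, with threshold [a], summed over the
    symbols.  The threshold vanishes when [p] is degenerate; all the central
    moments vanish then, and so do the probabilities. *)
Lemma sum_deviation_le (N : nat) :
  \sum_(1 <= i < N) binomial_mean n (p i)
     (fun k => (a < (k%:R - n%:R * p i) ^+ m)%R%:R) <= delta.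
Proof.
have p01 := @distribution_in01 R p pd.
have f0 i k : 0 <= (k%:R - n%:R * p i) ^+ m :> R by rewrite exprn_even_ge0.
have a0 : 0 <= a.
  by rewrite /a exprn_even_ge0.
have le_mom := @sum_central_moment_le p m n N pd m_gt0 m_even.
rewrite -(@moment_bound_expr p m n delta) // -/a in le_mom.
move: a0; rewrite le_eqVlt => /predU1P[aE|a_gt0]; last first.
  rewrite -(ler_pM2l a_gt0) [leRHS]mulrC; apply: le_trans le_mom.
  rewrite big_distrr /=; apply: ler_sum_nat => i /andP[i0 _].
  by apply: binomial_mean_markov => //; [exact: p01|exact: ltW].
rewrite -aE mulr0 in le_mom.
rewrite big_nat big1 ?ltW // => i iN; rewrite -aE.
apply: binomial_mean_support_eq0 => //; first by apply: p01; case/andP: iN.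
apply/eqP; rewrite eq_le binomial_mean_ge0 ?andbT //; last by apply: p01; case/andP: iN.
apply: le_trans le_mom; rewrite (bigD1_seq i) ?mem_index_iota ?iota_uniq //=.
rewrite lerDl big_nat_cond; apply: sumr_ge0 => j /andP[/andP[j0 _] _].
by apply: binomial_mean_ge0 => //; exact: p01.
Qed.

Lemma moment_bound_ge0 : 0 <= moment_bound p m n delta.
Proof.
rewrite mulr_ge0 ?mulr_ge0 ?divr_ge0 ?invr_ge0 ?powR_ge0 // sumr_ge0 //.
by move=> k _; rewrite powR_ge0.
Qed.

Lemma deviation_gtE (i k : nat) :
  (moment_bound p m n delta < `|p i - k%:R / n%:R|) =
  (a < (k%:R - n%:R * p i) ^+ m).
Proof.
have n0 : 0 < n%:R :> R by rewrite ltr0n.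
have dev0 : 0 <= (k%:R - n%:R * p i) ^+ m by rewrite exprn_even_ge0.
rewrite -[in RHS](ger0_norm dev0).
have nb0 : 0 <= n%:R * moment_bound p m n delta.
  by apply: mulr_ge0 => //; exact: moment_bound_ge0.
rewrite normrX /a ltr_pXn2r ?nnegrE //.
have -> : k%:R - n%:R * p i = - (n%:R * (p i - k%:R / n%:R)).
  by field; rewrite gt_eqF.
by rewrite normrN normrM (gtr0_norm n0) ltr_pM2l.
Qed.

(** The union bound over the symbols, each event being rewritten in terms of the
    [m]-th power of the centred count. *)
Lemma probability_sup_dist_le d (T : measurableType d) (P : probability T R)
    (X : 'I_n -> {RV P >-> nat}) : iid_sample p X ->
  ((1 - delta)%:E <=
     P [set w | sup_dist p (mle R (fun j => X j w))
                <= (moment_bound p m n delta)%:E])%E.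
Proof.
move=> Xiid.
set G := [set w | _].
pose D i k := (a < (k%:R - n%:R * p i) ^+ m).
pose F i := [set w | D i (count_symbol (fun j => X j w) i)].
have mF i : measurable (F i) by apply: measurable_count_symbol.
have GE : G = ~` \bigcup_(i in ~` `I_1) F i.
  apply/seteqP; split=> w /=.
    move=> Gw [i /= i0]; rewrite /F /= /D -deviation_gtE ltNge => /negP; apply.
    rewrite -lee_fin; apply: le_trans Gw; apply: ereal_sup_ubound.
    by exists i => //=; lia.
  move=> nF; apply: ge_ereal_sup => _ [i /= i0 <-]; rewrite lee_fin leNgt.
  apply/negP; rewrite deviation_gtE => Fi; apply: nF.
  by exists i => //=; lia.
have mU : measurable (\bigcup_(i in ~` `I_1) F i) by apply: bigcup_measurable.
rewrite GE probability_setC // EFinB leeB //.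
apply: le_trans (measure_sigma_subadditive_tail P mF mU (fun _ h => h)) _.
apply: lime_le; first exact: is_cvg_nneseries.
apply: nearW => N.
apply: (@le_trans _ _ (\sum_(1 <= i < N) binomial_mean n (p i) (fun k => (D i k)%:R))%:E).
  rewrite -sumEFin !big_nat; apply: lee_sum => i /andP[i0 _].
  exact: probability_count_symbol_le.
by rewrite lee_fin; exact: sum_deviation_le.
Qed.

End Deviation.

(** * Comparison with the leading term *)

(** The exponent on the right is [1 - K], and [exp (-1/2) >= 1/2]. *)
Lemma expR_invn_expr (K : nat) : (0 < K)%N ->
  4^-1 ^+ K.-1 <= expR (- 2^-1 + K.*2%:R^-1) ^+ K.*2 :> R.
Proof.
move=> K0.
have -> : expR (- 2^-1 + K.*2%:R^-1) ^+ K.*2 = expR (- 2^-1) ^+ K.-1.*2 :> R.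
  rewrite -!expRM_natl; congr expR.
  have -> : K = K.-1.+1 by rewrite prednK.
  move: (K.-1) => k; rewrite /= doubleS -!muln2 -!natr1 natrM.
  by field; rewrite -[2]/(2%:R) -natrM natr1 natr1 pnatr_eq0.
rewrite -muln2 mulnC exprM lerXn2r ?nnegrE ?exprn_ge0 ?expR_ge0 //.
by have := expR_ge1Dx (- 2^-1 : R); nra.
Qed.

(** For [k = m/2] the [m]-th power of the summand is
    [(m/2)^(m/2) n^(m/2)] times a series of sum at most [4^-(m/2 - 1)]. *)
Lemma leading_summand_le (p : nat -> R) (m n : nat) :
  is_distribution p -> (0 < m)%N -> ~~ odd m ->
  (m./2%:R ^+ (m - m./2) * n%:R ^+ m./2 *
     fine (\sum_(1 <= i <oo) (p i ^+ m./2 * (1 - p i) ^+ m./2)%:E)%E) `^ m%:R^-1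
  <= Num.sqrt n%:R * Num.sqrt (m%:R / 2) * expR (- 2^-1 + m%:R^-1).
Proof.
move=> pd m0 m_even; have mK := even_halfK m_even.
have K0 : (0 < m./2)%N by lia.
move: (m./2) mK K0 m0 {m_even} => K <- K0 m0.
have [leN lec] := @series_pq R p pd K K0.
have ser0 := leN 1%N; rewrite big_geq // in ser0.
apply: powR_invn_le; rewrite ?mulr_ge0 ?exprn_ge0 ?sqrtr_ge0 ?expR_ge0 //.
have -> : (K.*2 - K = K)%N by lia.
rewrite !exprMn.
have sq (x : R) : 0 <= x -> Num.sqrt x ^+ K.*2 = x ^+ K.
  by move=> x0; rewrite -muln2 mulnC exprM sqr_sqrtr.
rewrite !sq ?divr_ge0 //.
have -> : K.*2%:R / 2 = K%:R :> R by rewrite -muln2 natrM mulfK.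
rewrite [X in X * _]mulrC ler_wpM2l ?mulr_ge0 ?exprn_ge0 //.
exact: le_trans lec (@expR_invn_expr K K0).
Qed.

(** The series is at most 1, and [n^(-1 + k/m) <= n^(-(1/2 + 1/m))] as
    [k <= m/2 - 1]. *)
Lemma lower_summand_le (p : nat -> R) (m n k : nat) :
  is_distribution p -> (0 < m)%N -> (0 < k)%N -> (k.*2.+2 <= m)%N -> (0 < n)%N ->
  n%:R^-1 * (k%:R ^+ (m - k) * n%:R ^+ k *
     fine (\sum_(1 <= i <oo) (p i ^+ k * (1 - p i) ^+ k)%:E)%E) `^ m%:R^-1
  <= (k%:R ^+ (m - k)) `^ m%:R^-1 * (1 / n%:R `^ (2^-1 + m%:R^-1)).
Proof.
move=> pd m0 k0 km n0.
have [leN lec] := @series_pq R p pd k k0.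
have ser0 := leN 1%N; rewrite big_geq // in ser0.
have n1 : 1 <= n%:R :> R by rewrite ler1n.
have nn0 : 0 < n%:R :> R by rewrite ltr0n.
have mR : m%:R != 0 :> R by rewrite pnatr_eq0 -lt0n.
have le1 : fine (\sum_(1 <= i <oo) (p i ^+ k * (1 - p i) ^+ k)%:E)%E <= 1.
  by apply: le_trans lec _; rewrite exprn_ile1 // ?invr_ge0 // invf_le1 ?ler1n.
apply: (@le_trans _ _ (n%:R^-1 * (k%:R ^+ (m - k) * n%:R ^+ k) `^ m%:R^-1)).
  rewrite ler_wpM2l ?invr_ge0 // ge0_ler_powR ?invr_ge0 ?nnegrE ?mulr_ge0 ?exprn_ge0 //.
  by rewrite ler_piMr ?mulr_ge0 ?exprn_ge0 //.
rewrite powRM ?exprn_ge0 // mulrCA ler_wpM2l ?powR_ge0 //.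
rewrite mul1r -powRN -(powR_inv1 (ltW nn0)) -(powR_mulrn k (ltW nn0)) -powRrM -powRD.
  2: by rewrite (gt_eqF nn0) implybT.
apply: ler_powR => //.
rewrite -(@ler_pM2r _ m%:R) ?ltr0n //.
rewrite opprD !mulrDl !mulNr mulfVK // mulVf //.
have : k%:R * 2 + 2 <= m%:R :> R by rewrite -natrM -natrD ler_nat; lia.
by lra.
Qed.

Lemma moment_bound_asymptotic (m : nat) (delta : R) :
  (0 < m)%N -> ~~ odd m -> 0 < delta ->
  exists2 e : nat -> R,
    e =O_\oo (fun n : nat => 1 / n%:R `^ (2^-1 + m%:R^-1)) &
    forall (p : nat -> R) (n : nat), is_distribution p -> (0 < n)%N ->
      moment_bound p m n delta <= leading_term m n delta + e n.
Proof.
move=> m0 m_even d0; have mK := even_halfK m_even.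
have K0 : (0 < m./2)%N by lia.
pose C : R := (delta `^ m%:R^-1)^-1 * \sum_(1 <= k < m./2) (k%:R ^+ (m - k)) `^ m%:R^-1.
exists (fun n => C * (1 / n%:R `^ (2^-1 + m%:R^-1))).
  apply/eqO_exP; exists (`|C| + 1); first by rewrite ltr_pwDr.
  near=> n; rewrite normrM ler_wpM2r // lerDl //.
move=> p n pd n0.
have dm0 : 0 < delta `^ m%:R^-1 by rewrite powR_gt0.
have nn0 : 0 < n%:R :> R by rewrite ltr0n.
rewrite /moment_bound big_nat_recr //= mulrDr addrC lerD //.
  apply: le_trans (ler_wpM2l _ (@leading_summand_le p m n pd m0 m_even)) _.
    by rewrite mulr_ge0 ?divr_ge0 ?invr_ge0 ?ltW.
  rewrite /leading_term le_eqVlt; apply/orP; left; apply/eqP.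
  have s0 : Num.sqrt n%:R != 0 :> R by rewrite sqrtr_eq0 -ltNge.
  have -> : n%:R^-1 = (Num.sqrt n%:R)^-1 * (Num.sqrt n%:R)^-1 :> R.
    by rewrite -invfM -expr2 sqr_sqrtr ?ltW.
  by field; rewrite s0 gt_eqF.
rewrite [1 / delta `^ _]mul1r [n%:R^-1 * _]mulrC /C -!mulrA ler_wpM2l ?invr_ge0 ?powR_ge0 //.
rewrite big_distrr big_distrl /=; apply: ler_sum_nat => k /andP[k0 kK].
by apply: lower_summand_le => //; rewrite -mK -doubleS leq_double.
Unshelve. all: by end_near.
Qed.

End Bounds.

Theorem theorem1 (R : realType) (m : nat) (delta : R)
    (m_gt0 : (0 < m)%N) (m_even : ~~ odd m) (delta01 : 0 < delta < 1) :
  (forall (p : nat -> R) (n : nat), is_distribution p -> (0 < n)%N ->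
    forall (d : measure_display) (T : measurableType d) (P : probability T R)
      (X : 'I_n -> {RV P >-> nat}), iid_sample p X ->
    ((1 - delta)%:E <=
     P [set w | sup_dist p (mle R (fun j => X j w))
                <= (moment_bound p m n delta)%:E])%E) /\
  (exists2 e : nat -> R,
    e =O_\oo (fun n : nat => 1 / n%:R `^ (2^-1 + m%:R^-1)) &
    forall (p : nat -> R) (n : nat), is_distribution p -> (0 < n)%N ->
      moment_bound p m n delta <= leading_term m n delta + e n).
Proof.
have /andP[delta_gt0 _] := delta01.
split; last exact: moment_bound_asymptotic.
by move=> p n pd n_gt0 d T P X; exact: probability_sup_dist_le.
Qed.
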